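(* Let $\mathcal{C}$ be a nonempty embeddable right IP-quandle whose associated group $G_{\mathcal{C}}$ is finite, and let $k$ be a field not of characteristic $2$. Let $H^1_{dR}(G_{\mathcal{C}})$ be the first noncommutative de Rham cohomology of $k(G_{\mathcal{C}})$ for the bicovariant differential calculus defined by $\mathcal{C}\subseteq G_{\mathcal{C}}\setminus\{e\}$, and let $\theta=\sum_{a\in\mathcal{C}}\omega_a$. Then $H^1_{dR}(G_{\mathcal{C}})\supseteq k\theta$, the span of the element $\theta$ (that is, $\theta$ is closed and its class in $H^1_{dR}(G_{\mathcal C})$ is nonzero). Equality $H^1_{dR}(G_{\mathcal{C}})=k\theta$ holds if $\mathcal{C}$ is locally skew.
   Context: A right IP-quandle is a set $\mathcal{C}$ with an operation $(a,b)\mapsto a^b$ such that $(a^b)^c=(a^c)^{(b^c)}$, each map $(\ )^b$ is bijective, $a^a=a$, together with an involutive bijection $a\mapsto a^{-1}$ of $\mathcal{C}$ such that $(a^{-1})^b=(a^b)^{-1}$ and $(a^b)^{b^{-1}}=a$ for all $a,b,c\in\mathcal{C}$. Its associated group $G_{\mathcal{C}}$ is generated by $\mathcal{C}$ with relations $ab=b(a^b)$ and $a^{-1}a=e$ for all $a,b\in\mathcal{C}$ (here $a^{-1}$ denotes the generator given by the bijection). It is embeddable if the canonical map $\mathcal{C}\to G_{\mathcal{C}}$ is injective with image not containing $e$; then $a^b=b^{-1}ab$ in $G_{\mathcal{C}}$. Elements $a,b\in\mathcal{C}$ are mutually skew if $a^b=(b^a)^{-1}$. The IP-quandle $\mathcal{C}$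 is locally skew if the graph with vertex set $\mathcal{C}$ and an edge between two distinct elements whenever they are mutually skew is connected. Noncommutative de Rham complex in low degree: let $G$ be a finite group and $\mathcal{C}\subseteq G\setminus\{e\}$ a generating subset stable under conjugation and inversion. Let $k(G)$ be the algebra of $k$-valued functions on $G$ and $R_a(f)(x)=f(xa)$. The space $\Omega^1$ is the free left $k(G)$-module with basis $\{\omega_a\}_{a\in\mathcal{C}}$, with right multiplication $\omega_a f=R_a(f)\omega_a$, and $\mathrm{d}:k(G)\to\Omega^1$ is $\mathrm{d}f=\sum_{a\in\mathcal{C}}(R_a(f)-f)\omega_a$. The space $\Omega^2$ is the quotient of $\Omega^1\otimes_{k(G)}\Omega^1$ (product denoted $\wedge$) by the relations $\sum v_{a,b}\,\omega_a\wedge\omega_b=0$ if and only if $\sum v_{a,b}\,\omega_a\otimes\omega_b\in\ker(\mathrm{id}-\tilde\Psi)$, where $v_{a,b}\in k(G)$ and $\tilde\Psi$ is the left $k(G)$-linear map with $\tilde\Psi(\omega_a\otimes\omega_b)=\omega_{aba^{-1}}\otimes\omega_a$. With $\theta=\sum_{a\in\mathcal{C}}\omega_a$, $\mathrm{d}:\Omega^1\to\Omega^2$ is $\mathrm{d}\omega=\theta\wedge\omega+\omega\wedge\theta$. Then $H^1_{dR}(G)=\{\omega\in\Omega^1:\mathrm{d}\omega=0\}/\mathrm{d}(k(G))$. *)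

(* Defs.v *)
From HB Require Import structures.
From Stdlib Require Import Relations.
From mathcomp Require Import all_boot all_order all_fingroup all_algebra.
From mathcomp Require Import boolp classical_sets cardinality.

Set Implicit Arguments.
Unset Strict Implicit.
Unset Printing Implicit Defensive.

Import GRing.Theory.
Local Open Scope quotient_scope.
Local Open Scope ring_scope.

Local Notation qrepr := generic_quotient.repr.

(* [qact a b] is a^b and [qinv a] is the formal inverse of a in the quandle. *)
Record ipquandle := IPQuandle {
  quandle_sort :> Type;
  qact : quandle_sort -> quandle_sort -> quandle_sort;
  qinv : quandle_sort -> quandle_sort;
  qactD : forall a b c, qact (qact a b) c = qact (qact a c) (qact b c);
  qact_bij : forall b, bijective (fun a => qact a b);
  qactid : forall a, qact a a = a;
  qinvK : involutive qinv;
  qactVl : forall a b, qact (qinv a) b = qinv (qact a b);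
  qactVK : forall a b, qact (qact a b) (qinv b) = a
}.

Section LocallySkew.
Variable C : ipquandle.

Definition mutually_skew (a b : C) : Prop := qact a b = qinv (qact b a).

Definition skew_edge (a b : C) : Prop := a <> b /\ mutually_skew a b.

(* Connectedness of the (undirected) graph: [skew_edge] is symmetric, see
   [skew_edge_sym], so paths are given by its reflexive transitive closure. *)
Definition locally_skew : Prop :=
  forall a b : C, clos_refl_trans C skew_edge a b.

Lemma skew_edge_sym a b : skew_edge a b -> skew_edge b a.
Proof.
move=> [ab s]; split; first by move=> e; apply: ab.
by rewrite /mutually_skew s qinvK.
Qed.

End LocallySkew.

(* The associated group: words in the letters [(a, false)] (the generator a)
   and [(a, true)] (its inverse in the free group), modulo the least congruence
   making the two letters mutually inverse and imposing ab = b(a^b) and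
   a^{-1}a = e, where this last a^{-1} is the generator [qinv a]. *)
Section AssociatedGroup.
Variable C : ipquandle.

Definition word := seq (C * bool).

Definition letter_inv (l : C * bool) : C * bool := (l.1, ~~ l.2).

Definition word_inv (w : word) : word := rev (map letter_inv w).

Inductive word_eq : word -> word -> Prop :=
| word_refl w : word_eq w w
| word_sym w1 w2 : word_eq w1 w2 -> word_eq w2 w1
| word_trans w2 w1 w3 : word_eq w1 w2 -> word_eq w2 w3 -> word_eq w1 w3
| word_cat v1 v2 w1 w2 :
    word_eq v1 w1 -> word_eq v2 w2 -> word_eq (v1 ++ v2) (w1 ++ w2)
| word_cancel l : word_eq [:: l; letter_inv l] [::]
| word_conj a b :
    word_eq [:: (a, false); (b, false)] [:: (b, false); (qact a b, false)]
| word_qinv a : word_eq [:: (qinv a, false); (a, false)] [::].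

Definition word_eqb (v w : {classic word}) : bool := `[< word_eq v w >].

Lemma word_eqb_equiv : equiv_class_of word_eqb.
Proof.
split=> [w|v w|w v u].
- exact/asboolP/word_refl.
- by apply/asboolP/asboolP => /word_sym.
- by move=> /asboolP vw /asboolP wu; apply/asboolP/(word_trans vw).
Qed.

Canonical word_eqb_equiv_rel := EquivRelPack word_eqb_equiv.

Definition assoc_group := {eq_quot word_eqb}.

HB.instance Definition _ := Choice.on assoc_group.

Definition assoc_class (w : word) : assoc_group := \pi_assoc_group (w : {classic word}).

Lemma assoc_classP v w : assoc_class v = assoc_class w <-> word_eq v w.
Proof.
split; last by move=> vw; apply/eqP; rewrite eqmodE; apply/asboolP.
by move=> /eqP; rewrite eqmodE => /asboolP.
Qed.

Definition assoc_mul (x y : assoc_group) := assoc_class (qrepr x ++ qrepr y).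
Definition assoc_inv (x : assoc_group) := assoc_class (word_inv (qrepr x)).

Lemma assoc_classK x : assoc_class (qrepr x) = x.
Proof. exact: reprK. Qed.

Lemma repr_class w : word_eq (qrepr (assoc_class w)) w.
Proof. by apply/assoc_classP; rewrite assoc_classK. Qed.

Lemma assoc_class_cat v w :
  assoc_mul (assoc_class v) (assoc_class w) = assoc_class (v ++ w).
Proof. by apply/assoc_classP/word_cat; apply: repr_class. Qed.

Lemma letter_invK : involutive letter_inv.
Proof. by case=> a b; rewrite /letter_inv /= negbK. Qed.

Lemma word_catV w : word_eq (w ++ word_inv w) [::].
Proof.
elim: w => [|l w IHw]; first exact: word_refl.
rewrite /word_inv map_cons rev_cons -cats1 -cat1s -catA.
apply: word_trans (word_cancel l).
rewrite -[[:: l; _]]/([:: l] ++ [:: letter_inv l]).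
apply: word_cat; first exact: word_refl.
rewrite catA -[X in word_eq _ X]cat0s.
by apply: word_cat IHw _; apply: word_refl.
Qed.

Lemma word_invK : involutive word_inv.
Proof.
by move=> w; rewrite /word_inv map_rev revK mapK //; apply: letter_invK.
Qed.

Lemma word_catVl w : word_eq (word_inv w ++ w) [::].
Proof. by rewrite -{2}[w]word_invK; apply: word_catV. Qed.

Lemma assoc_mulA : associative assoc_mul.
Proof.
move=> x y z; rewrite -[x]assoc_classK -[y]assoc_classK -[z]assoc_classK.
by rewrite !assoc_class_cat catA.
Qed.

Lemma assoc_mul1g : left_id (assoc_class [::]) assoc_mul.
Proof. by move=> x; rewrite -[x]assoc_classK assoc_class_cat. Qed.

Lemma assoc_mulg1 : right_id (assoc_class [::]) assoc_mul.
Proof. by move=> x; rewrite -[x]assoc_classK assoc_class_cat cats0. Qed.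

Lemma assoc_mulVg : left_inverse (assoc_class [::]) assoc_inv assoc_mul.
Proof.
move=> x; rewrite -{2}[x]assoc_classK assoc_class_cat.
by apply/assoc_classP/word_catVl.
Qed.

Lemma assoc_mulgV : right_inverse (assoc_class [::]) assoc_inv assoc_mul.
Proof.
move=> x; rewrite -{1}[x]assoc_classK assoc_class_cat.
by apply/assoc_classP/word_catV.
Qed.

HB.instance Definition _ := isGroup.Build assoc_group
  assoc_mulA assoc_mul1g assoc_mulg1 assoc_mulVg assoc_mulgV.

Definition assoc_gen (a : C) : assoc_group := assoc_class [:: (a, false)].

Definition embeddable : Prop :=
  injective assoc_gen /\ forall a : C, assoc_gen a <> 1%g.

Lemma assoc_gen_conj a b :
  (assoc_gen a * assoc_gen b = assoc_gen b * assoc_gen (qact a b))%g.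
Proof.
by rewrite [LHS]assoc_class_cat [RHS]assoc_class_cat; apply/assoc_classP/word_conj.
Qed.

Lemma assoc_gen_inv a : assoc_gen (qinv a) = ((assoc_gen a)^-1)%g.
Proof.
apply: (mulIg (assoc_gen a)); rewrite mulVg.
by rewrite [LHS]assoc_class_cat; apply/assoc_classP/word_qinv.
Qed.

Lemma assoc_genJ a b : assoc_gen (qact a b) = (assoc_gen a ^ assoc_gen b)%g.
Proof. by rewrite conjgE assoc_gen_conj mulKg. Qed.

(* Universal property of the presentation. *)
Section Universal.
Variables (H : groupType) (f : C -> H).
Hypothesis f_conj : forall a b, (f a * f b = f b * f (qact a b))%g.
Hypothesis f_inv : forall a, (f (qinv a) * f a = 1)%g.

Definition letter_eval (l : C * bool) : H := if l.2 then ((f l.1)^-1)%g else f l.1.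
Definition word_eval (w : word) : H := (\prod_(l <- w) letter_eval l)%g.

Lemma word_eval_eq v w : word_eq v w -> word_eval v = word_eval w.
Proof.
elim=> {v w} // [v w u _ -> //|v1 v2 w1 w2 _ e1 _ e2|l|a b|a].
- by rewrite /word_eval !big_cat /=; congr (_ * _)%g.
- case: l => a [];
  by rewrite /word_eval !big_cons big_nil mulg1 /letter_eval /= ?mulgV ?mulVg.
- by rewrite /word_eval !big_cons big_nil !mulg1 /letter_eval /= f_conj.
- by rewrite /word_eval !big_cons big_nil !mulg1 /letter_eval /= f_inv.
Qed.

Lemma assoc_group_lift :
  exists2 F : assoc_group -> H,
    {morph F : x y / (x * y)%g} & forall a, F (assoc_gen a) = f a.
Proof.
exists (fun x => word_eval (qrepr x)) => [x y|a].
  by rewrite (word_eval_eq (repr_class _)) /word_eval big_cat.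
by rewrite (word_eval_eq (repr_class _)) /word_eval big_seq1.
Qed.

End Universal.

End AssociatedGroup.

(* The associated group as a [finGroupType], given that it is finite. *)
Section FiniteAssociatedGroup.
Variables (C : ipquandle) (fin : finite_set [set: assoc_group C]).

Definition fin_assoc_group of finite_set [set: assoc_group C] : Type :=
  assoc_group C.

Local Notation G := (fin_assoc_group fin).

HB.instance Definition _ := Group.on G.

Lemma fin_assoc_seqP : exists s : seq G, forall x, x \in s.
Proof.
have /finite_seqP [s sE] := fin; exists s => x.
have : [set: assoc_group C]%classic x by [].
by rewrite sE.
Qed.

Definition fin_assoc_enum : seq G := undup (sval (cid fin_assoc_seqP)).

Lemma fin_assoc_enumP x : count_mem x fin_assoc_enum = 1%N.
Proof.
rewrite count_uniq_mem ?undup_uniq // mem_undup.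
by case: cid => s /= ->.
Qed.

Definition fin_assoc_pickle (x : G) : nat := index x fin_assoc_enum.
Definition fin_assoc_unpickle (n : nat) : option G := onth fin_assoc_enum n.

Lemma fin_assoc_pickleK : pcancel fin_assoc_pickle fin_assoc_unpickle.
Proof.
move=> x; have xs : x \in fin_assoc_enum.
  by rewrite -has_pred1 has_count fin_assoc_enumP.
rewrite /fin_assoc_unpickle /fin_assoc_pickle.
by rewrite onthE (nth_map x) ?index_mem // nth_index.
Qed.

HB.instance Definition _ := isCountable.Build G fin_assoc_pickleK.
HB.instance Definition _ := isFinite.Build G fin_assoc_enumP.

Definition assoc_finGroup : finGroupType := G.

End FiniteAssociatedGroup.

Section QuotientSpace.
Variables (F : fieldType) (V : vectType F) (W : {vspace V}).

Definition vquot : Type := Quotient.quot (pred_of_vspace W).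

HB.instance Definition _ := GRing.Zmodule.on vquot.

Definition vclass (v : V) : vquot := \pi_(Quotient.quot (pred_of_vspace W)) v.

Lemma vclass_eq u v : (vclass u = vclass v) <-> (u - v \in W).
Proof.
split=> [/eqP|uv]; first by rewrite -Quotient.idealrBE.
by apply/eqP; rewrite -Quotient.idealrBE.
Qed.

Lemma vclassD : {morph vclass : u v / u + v}.
Proof. by move=> u v; rewrite /vclass piE. Qed.

Lemma vclass_repr x : vclass (qrepr x) = x.
Proof. exact: reprK. Qed.

Definition vquot_scale (c : F) (x : vquot) : vquot := vclass (c *: qrepr x).

Lemma vquot_scaleE c v : vquot_scale c (vclass v) = vclass (c *: v).
Proof.
by apply/vclass_eq; rewrite -scalerBr memvZ //; apply/vclass_eq/vclass_repr.
Qed.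

Lemma vquot_scaleA a b x : vquot_scale a (vquot_scale b x) = vquot_scale (a * b) x.
Proof. by rewrite -[x]vclass_repr !vquot_scaleE scalerA. Qed.

Lemma vquot_scale1 : left_id 1 vquot_scale.
Proof. by move=> x; rewrite -[x]vclass_repr !vquot_scaleE scale1r. Qed.

Lemma vquot_scaleDr : right_distributive vquot_scale +%R.
Proof.
move=> a x y; rewrite -[x]vclass_repr -[y]vclass_repr.
by rewrite -vclassD !vquot_scaleE -vclassD scalerDr.
Qed.

Lemma vquot_scaleDl x : {morph vquot_scale^~ x : a b / a + b}.
Proof.
by move=> a b; rewrite -[x]vclass_repr !vquot_scaleE -vclassD scalerDl.
Qed.

HB.instance Definition _ := GRing.Zmodule_isLmodule.Build F vquot
  vquot_scaleA vquot_scale1 vquot_scaleDr vquot_scaleDl.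

Lemma vclass_is_linear : linear vclass.
Proof. by move=> a u v; rewrite vclassD -vquot_scaleE. Qed.

HB.instance Definition _ := GRing.isSemilinear.Build F V vquot _ vclass
  (GRing.semilinear_linear vclass_is_linear).

Lemma vquot_vect_iso : Vector.axiom (\dim (W^C)) vquot.
Proof.
pose q v := v - projv W v.
have qC v : q v \in (W^C)%VS by apply: memv_projC.
have qlin : linear q.
  by move=> a u v; rewrite /q linearP scalerBr addrACA opprD.
have qeq u v : u - v \in W -> q u = q v.
  move=> uvW; apply/eqP; rewrite -subr_eq0 /q opprD opprK addrACA.
  by rewrite [- _ + _]addrC -(opprB (projv W u)) -(linearB (projv W)) /= projv_id // subrr.
have qclass v : vclass (q v) = vclass v.
  by apply/vclass_eq; rewrite /q addrAC subrr add0r memvN memv_proj.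
have qrE v : q (qrepr (vclass v)) = q v by apply/qeq/vclass_eq/vclass_repr.
pose B := vbasis (W^C)%VS.
exists (fun x => \row_i coord B i (q (qrepr x))).
  move=> a x y; rewrite -[x]vclass_repr -[y]vclass_repr -linearP.
  by apply/rowP=> i; rewrite !mxE !qrE qlin linearP.
exists (fun r : 'rV_(\dim W^C) => vclass (\sum_i r 0 i *: B`_i)).
  move=> x; rewrite -[RHS]vclass_repr -[RHS]qclass; congr vclass.
  by rewrite [RHS](coord_vbasis (qC _)); apply: eq_bigr => i _; rewrite mxE.
move=> r; apply/rowP=> i; rewrite mxE qrE.
set w := \sum_i _.
have wC : w \in (W^C)%VS.
  by apply: rpred_sum => j _; rewrite rpredZ ?vbasis_mem ?memt_nth.
suff -> : q w = w by rewrite coord_sum_free ?(basis_free (vbasisP _)).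
suff w0 : projv W w = 0 by rewrite /q w0 subr0.
by apply/eqP; rewrite -memv_ker lker_proj.
Qed.

HB.instance Definition _ := Lmodule_hasFinDim.Build F vquot vquot_vect_iso.

End QuotientSpace.

(* The calculus on k(G) attached to S \subset G, used below for S a generating
   set stable under conjugation and inversion and not containing 1 (see
   [quandle_image_calculus]). A 1-form \sum_a w_a \omega_a is encoded by its
   coefficients w : S -> k(G) in the basis (\omega_a), and an element of
   \Omega^1 \otimes_{k(G)} \Omega^1 by its coefficients in the left k(G)-basis
   (\omega_a \otimes \omega_b). *)
Section Calculus.
Variables (k : fieldType) (G : finGroupType) (S : {set G}).

Local Notation idx := {a : G | a \in S}.
Local Notation fn := {ffun G -> k^o}.
Local Notation Omega1 := {ffun idx -> fn}.
Local Notation Tensor2 := {ffun idx * idx -> fn}.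

Implicit Types (f : fn) (w v : Omega1) (t : Tensor2).

Definition Rt (a : G) f : fn := [ffun x => f (x * a)%g].

Definition lmul1 f w : Omega1 := [ffun a => f * w a].
Definition rmul1 w f : Omega1 := [ffun a => w a * Rt (val a) f].

(* The basis element \omega_g; by convention it is 0 when g is not in S. *)
Definition omega (g : G) : Omega1 := [ffun a => [ffun=> (val a == g)%:R]].

Definition d0 f : Omega1 :=
  \sum_(a : idx) lmul1 (Rt (val a) f - f) (omega (val a)).

Definition lmul2 f t : Tensor2 := [ffun ab => f * t ab].

(* (w_a \omega_a) \otimes (v_b \omega_b) = w_a R_a(v_b) \omega_a \otimes \omega_b *)
Definition tensor w v : Tensor2 :=
  [ffun ab => w ab.1 * Rt (val ab.1) (v ab.2)].

Definition Psi t : Tensor2 :=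
  \sum_(a : idx) \sum_(b : idx)
     lmul2 (t (a, b))
       (tensor (omega (val a * val b * (val a)^-1)%g) (omega (val a))).

Definition Omega2 := vquot (lker (\1 - linfun Psi)%VF).

HB.instance Definition _ := Vector.on Omega2.

Definition wedge w v : Omega2 := vclass _ (tensor w v).

Definition theta : Omega1 := \sum_(a : idx) omega (val a).

Definition d1 w : Omega2 := wedge theta w + wedge w theta.

Lemma omega_rmul (a : idx) f :
  rmul1 (omega (val a)) f = lmul1 (Rt (val a) f) (omega (val a)).
Proof.
apply/ffunP=> b; apply/ffunP=> x; rewrite !ffunE.
by case: eqVneq => [->|_]; rewrite ?mulr1 ?mul1r ?mul0r ?mulr0.
Qed.

Lemma tensor_balanced w f v : tensor (rmul1 w f) v = tensor w (lmul1 f v).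
Proof. by apply/ffunP=> ab; apply/ffunP=> x; rewrite !ffunE mulrA. Qed.

Lemma thetaE (a : idx) : theta a = [ffun=> 1].
Proof.
apply/ffunP=> x; rewrite sum_ffunE sum_ffunE (bigD1 a) //= big1 => [|b ba].
  by rewrite !ffunE eqxx addr0.
by rewrite !ffunE eq_sym val_eqE (negPf ba).
Qed.

Lemma d0E f (a : idx) : d0 f a = Rt (val a) f - f.
Proof.
apply/ffunP=> x; rewrite sum_ffunE sum_ffunE (bigD1 a) //= big1 => [|b ba].
  by rewrite !ffunE eqxx mulr1 addr0.
by rewrite !ffunE eq_sym val_eqE (negPf ba) mulr0.
Qed.

Lemma d0_is_linear : linear d0.
Proof.
move=> c f g; apply/ffunP=> a; apply/ffunP=> x.
by rewrite d0E !ffunE d0E d0E !ffunE scalerBr addrACA opprD.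
Qed.
HB.instance Definition _ := GRing.isSemilinear.Build k fn Omega1 _ d0
  (GRing.semilinear_linear d0_is_linear).

Lemma Psi_is_linear : linear Psi.
Proof.
move=> c t u; rewrite /Psi scaler_sumr -big_split; apply: eq_bigr => a _ /=.
rewrite scaler_sumr -big_split; apply: eq_bigr => b _ /=.
apply/ffunP=> p; apply/ffunP=> x; rewrite !ffunE.
by rewrite mulrDl scalerAl.
Qed.
HB.instance Definition _ := GRing.isSemilinear.Build k Tensor2 Tensor2 _ Psi
  (GRing.semilinear_linear Psi_is_linear).

Lemma d1E w : d1 w = vclass _ (tensor theta w + tensor w theta).
Proof. by rewrite /d1 /wedge -linearD. Qed.

Lemma d1_is_linear : linear d1.
Proof.
move=> c w v; rewrite !d1E -linearP; congr vclass.
apply/ffunP=> p; apply/ffunP=> x; rewrite !ffunE.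
by rewrite mulrDr mulrDl scalerDr addrACA -scalerAl -scalerAr.
Qed.
HB.instance Definition _ := GRing.isSemilinear.Build k Omega1 Omega2 _ d1
  (GRing.semilinear_linear d1_is_linear).

Definition closed1 : {vspace Omega1} := lker (linfun d1).
Definition exact1 : {vspace Omega1} := limg (linfun d0).

Definition dR_class w : vquot exact1 := vclass exact1 w.
HB.instance Definition _ := GRing.Linear.copy dR_class (vclass exact1).

(* [closed1] modulo [exact1], realised inside \Omega^1 / d(k(G)); recall that
   [exact1] is contained in [closed1], see [exact1_closed]. *)
Definition HdR1 : {vspace vquot exact1} := (linfun dR_class @: closed1)%VS.

Lemma closed1P w : (w \in closed1) = (d1 w == 0).
Proof. by rewrite memv_ker lfunE. Qed.

Lemma exact1P w : reflect (exists f, w = d0 f) (w \in exact1).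
Proof.
apply: (iffP memv_imgP) => [[f _ ->]|[f ->]]; exists f; rewrite ?lfunE ?memvf //.
Qed.

Lemma HdR1P h :
  reflect (exists2 w, d1 w = 0 & h = dR_class w) (h \in HdR1).
Proof.
apply: (iffP memv_imgP) => [[w wZ ->]|[w wZ ->]]; exists w.
- by apply/eqP; rewrite -closed1P.
- by rewrite lfunE.
- by rewrite closed1P wZ.
- by rewrite lfunE.
Qed.

Section Stable.
Hypothesis Sconj : forall a b, a \in S -> b \in S -> (a ^ b)%g \in S.

Lemma PsiE t (a b : idx) :
  Psi t (a, b) = t (b, Sub (val a ^ val b)%g (Sconj (valP a) (valP b))).
Proof.
set c : idx := Sub _ _; apply/ffunP=> x.
rewrite !sum_ffunE (bigD1 b) //= [X in _ + X]big1 => [|d db]; last first.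
  rewrite !sum_ffunE big1 // => e _.
  by rewrite !ffunE /= (eq_sym (val b)) val_eqE (negPf db) !mulr0.
rewrite !sum_ffunE (bigD1 c) //= [X in _ + X + _]big1 => [|d dc]; last first.
  rewrite !ffunE /= [val a == _](negPf _) ?mul0r ?mulr0 //.
  apply: contra dc => /eqP e; rewrite -val_eqE /= conjgE e.
  by rewrite !mulgA mulVg mul1g mulgKV.
rewrite !ffunE /= !eqxx.
by rewrite conjgE !mulgA mulgV mul1g mulgK eqxx !mulr1 !addr0.
Qed.

Lemma exact1_closed : (exact1 <= closed1)%VS.
Proof.
apply/subvP=> _ /exact1P[f ->]; rewrite closed1P d1E; apply/eqP.
rewrite -[RHS](linear0 (vclass _)); apply/vclass_eq; rewrite subr0.
rewrite memv_ker add_lfunE opp_lfunE id_lfunE lfunE subr_eq0; apply/eqP.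
apply/ffunP=> -[a b]; rewrite PsiE; apply/ffunP=> x.
rewrite !ffunE /= !thetaE !d0E !ffunE /= !mul1r !mulr1.
rewrite !addrA !subrK.
by rewrite conjgE !mulgA mulgK.
Qed.

End Stable.

End Calculus.

Section QuandleCalculus.
Variables (C : ipquandle) (fin : finite_set [set: assoc_group C]).

Local Notation G := (assoc_finGroup fin).

Definition fin_gen (a : C) : G := assoc_gen a.

Definition quandle_image : {set G} :=
  [set g : G | `[< exists a : C, fin_gen a = g >]].

Lemma quandle_imageP (g : G) :
  reflect (exists a : C, fin_gen a = g) (g \in quandle_image).
Proof. by rewrite /quandle_image finset.in_set; apply: asboolP. Qed.

Lemma quandle_image_calculus : embeddable C ->
  [/\ (1%g : G) \notin quandle_image,
      <<quandle_image>>%g = [set: G]%SET,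
      forall a b, a \in quandle_image -> b \in quandle_image ->
        (a ^ b)%g \in quandle_image &
      forall a, a \in quandle_image -> (a^-1)%g \in quandle_image].
Proof.
move=> [_ gen_neq1]; split.
- by apply/quandle_imageP => -[a /gen_neq1].
- apply/setP=> x; rewrite [RHS]finset.in_setT -[x]assoc_classK.
  elim: (qrepr _) => [|[a b] w IHw]; first exact: group1.
  have -> : assoc_class ((a, b) :: w) =
    ((assoc_class [:: (a, b)] : G) * assoc_class w)%g :> G.
    by rewrite [RHS]assoc_class_cat.
  rewrite groupM //.
  have genS : fin_gen a \in <<quandle_image>>%g.
    by apply/mem_gen/quandle_imageP; exists a.
  case: b => //.
  suff -> : assoc_class [:: (a, true)] = ((fin_gen a)^-1)%g :> G.
    by rewrite groupV.
  apply: (mulIg (fin_gen a)); rewrite mulVg [LHS]assoc_class_cat.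
  exact/assoc_classP/(word_cancel (a, true) : word_eq _ [::]).
- move=> _ _ /quandle_imageP[a <-] /quandle_imageP[b <-]; apply/quandle_imageP.
  by exists (qact a b); apply: assoc_genJ.
- move=> _ /quandle_imageP[a <-]; apply/quandle_imageP.
  by exists (qinv a); apply: assoc_gen_inv.
Qed.

End QuandleCalculus.

Arguments quandle_image {C} fin.
Arguments theta k {G} S.
Arguments HdR1 k {G} S.

(* Main.v *)
Require Import Defs.
From mathcomp Require Import all_boot all_order all_fingroup all_algebra.
From mathcomp Require Import boolp classical_sets cardinality.

Import GRing.Theory.
Local Open Scope ring_scope.

Local Notation qact := Defs.qact.
Local Notation qrepr := generic_quotient.repr.

(** A 1-form [w] is a labelling of the oriented edges x -> x a of the Cayley
    graph of the associated group, the edge carrying the label w_a(x). The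
    coefficient of theta (x) w + w (x) theta at omega_a (x) omega_b is
    w_a(x) + w_b(x a), the total label of the path x -> x a -> x a b, and a
    tensor vanishes in degree 2 exactly when its coefficients at (a, b) and
    (b, a^b) always agree. So w is closed if and only if the two sides of each
    relation a b = b (a^b), read as paths from any vertex, have the same
    total label ([d1_eq0P]). Being exact means that the total
    label of a path depends only on its end points. The associated group is
    presented by the relations a b = b (a^b) and a^{-1} a = e, so the
    only obstruction for a closed form to be exact is the total label
    u_a(x) of the round trip x -> x a -> x ([closed_turn0_potential]).

    For the form theta every label is 1, so that its round trips have label 2:
    theta is closed, but not exact in characteristic other than 2.

    Conversely, let w be closed. The round trip along a can be moved across
    any edge b in two ways: passing b through a and then through a^{-1}
    changes b into b again, whence u_a(x b) = u_a(x), and passing a and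
    a^{-1} through b gives u_a(x) = u_{a^b}(x b). Hence u_a is a constant
    that depends only on the conjugacy class of a ([turn_const],
    [turn_qact]); besides, u_{a^{-1}} = u_a. If a and b are mutually skew, then
    u_a = u_{a^b} = u_{(b^a)^{-1}} = u_{b^a} = u_b, so that on a locally skew
    quandle all round trips have the same label c ([turn_locally_skew]).
    Then w - (c/2) theta is closed with zero round trips, hence exact. *)

(** * Edge labellings of the Cayley graph of the associated group *)

Section Labelling.

Variables (C : ipquandle) (V : zmodType).
Local Notation G := (assoc_group C).

Implicit Types (W : C -> G -> V) (a b : C) (x y : G) (v w : word C).

Definition closed_labelling W : Prop := forall a b x,
  W a x + W b (x * assoc_gen a)%g = W b x + W (qact a b) (x * assoc_gen b)%g.

(** The total label of the round trip x -> x a -> x. *)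
Definition turn W a x : V := W a x + W (qinv a) (x * assoc_gen a)%g.

Lemma mul_assoc_genV x a : (x * assoc_gen a * assoc_gen (qinv a))%g = x.
Proof. by rewrite assoc_gen_inv mulgK. Qed.

Lemma assoc_classM v w :
  assoc_class (v ++ w) = (assoc_class v * assoc_class w)%g.
Proof. by rewrite -assoc_class_cat. Qed.

Lemma assoc_class_true a : assoc_class [:: (a, true)] = ((assoc_gen a)^-1)%g.
Proof.
apply: (mulIg (assoc_gen a)); rewrite mulVg -assoc_classM.
exact/assoc_classP/(word_cancel (a, true)).
Qed.

(** The equivalence takes care of the inverses of the generators. *)
Lemma assoc_groupP (P : G -> Prop) :
    P 1%g -> (forall x a, P x <-> P (x * assoc_gen a)%g) ->
  forall x, P x.
Proof.
move=> P1 Pgen x; rewrite -[x]assoc_classK.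
elim/last_ind: (qrepr x) => [|w [a s] IHw] //.
rewrite -cats1 assoc_classM; case: s.
  by apply/(Pgen _ a); rewrite assoc_class_true mulgKV.
exact: (Pgen (assoc_class w) a).1.
Qed.

(** The label of a letter read from [x]; the formal inverse of [a] walks back
    along the edge labelled [W a], with the opposite sign. *)
Definition letter_label W (l : C * bool) x : V :=
  if l.2 then - W l.1 (x * (assoc_gen l.1)^-1)%g else W l.1 x.

Fixpoint path_label W w x : V :=
  if w is l :: w' then
    letter_label W l x + path_label W w' (x * assoc_class [:: l])%g
  else 0.

Lemma path_label_cat W v w x :
  path_label W (v ++ w) x
    = path_label W v x + path_label W w (x * assoc_class v)%g.
Proof.
elim: v x => [|l v IHv] x /=; first by rewrite add0r mulg1.
by rewrite IHv addrA -mulgA -assoc_classM.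
Qed.

Lemma path_label_word_eq W :
    closed_labelling W -> (forall a x, turn W a x = 0) ->
  forall v w x, word_eq v w -> path_label W v x = path_label W w x.
Proof.
move=> Wcl W0 v w x vw; elim: vw x => {v w}
  [//|v w _ IH x|v w u _ IH1 _ IH2 x|v1 v2 w1 w2 e1 IH1 e2 IH2 x|[a s] x|a b x|a x].
- by rewrite IH.
- by rewrite IH1.
- by rewrite !path_label_cat IH1 IH2 ((assoc_classP _ _).2 e1).
- rewrite /= /letter_label /= addr0; case: s => /=.
    by rewrite assoc_class_true addNr.
  by rewrite mulgK addrN.
- by rewrite /= /letter_label /= !addr0; apply: Wcl.
- have := W0 (qinv a) x; rewrite /turn qinvK.
  by rewrite /= /letter_label /= addr0.
Qed.

(** Reading words from the unit defines a potential, because the labels of all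
    relators vanish. *)
Lemma closed_turn0_potential W :
    closed_labelling W -> (forall a x, turn W a x = 0) ->
  exists f : G -> V, forall a x, W a x = f (x * assoc_gen a)%g - f x.
Proof.
move=> Wcl W0; exists (fun x => path_label W (qrepr x) 1%g) => a x.
have -> : path_label W (qrepr (x * assoc_gen a)%g) 1%g
        = path_label W (qrepr x ++ [:: (a, false)]) 1%g.
  apply: path_label_word_eq => //; apply/assoc_classP.
  by rewrite assoc_classK assoc_classM assoc_classK.
by rewrite path_label_cat assoc_classK mul1g /= /letter_label /= addr0 addrC addKr.
Qed.

Section ClosedLabelling.
Variable W : C -> G -> V.
Hypothesis Wcl : closed_labelling W.

Lemma turn_qinv a x : turn W (qinv a) x = turn W a x.
Proof.
(* The relation a a^{-1} = a^{-1} a^{a^{-1}}, where a^{a^{-1}} = a. *)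
have aaV : qact a (qinv a) = a by rewrite -{1}(qactid a) qactVK.
by have := Wcl a (qinv a) x; rewrite /turn qinvK aaV => ->.
Qed.

(** A generator [b] that passes through [a] and then through its inverse comes
    out unchanged, so a round trip may be moved along the edge [b]. *)
Lemma turn_step a b x : turn W a (x * assoc_gen b)%g = turn W a x.
Proof.
have e1 := Wcl b a x.
have e2 := Wcl (qact b a) (qinv a) (x * assoc_gen a)%g.
rewrite qactVK mul_assoc_genV in e2.
have ebab : (x * assoc_gen a * assoc_gen (qact b a))%g
          = (x * assoc_gen b * assoc_gen a)%g.
  by rewrite -!mulgA (assoc_gen_conj b a).
rewrite ebab in e2.
by apply: (addrI (W b x)); rewrite /turn addrA e1 -addrA e2 addrA addrC.
Qed.

Lemma turn_const a x y : turn W a x = turn W a y.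
Proof.
suff turn1 z : turn W a z = turn W a 1%g by rewrite !turn1.
by elim/assoc_groupP: z => // z b; rewrite turn_step.
Qed.

(** A round trip along [a] followed by [b] is [b] followed by a round trip along
    the conjugate of [a]. *)
Lemma turn_qact a b x : turn W (qact a b) x = turn W a x.
Proof.
rewrite -(turn_step (qact a b) b).
have e1 := Wcl a b x.
have e2 := Wcl (qinv a) b (x * assoc_gen a)%g.
rewrite mul_assoc_genV qactVl in e2.
have eaab : (x * assoc_gen a * assoc_gen b)%g
          = (x * assoc_gen b * assoc_gen (qact a b))%g.
  by rewrite -!mulgA (assoc_gen_conj a b).
rewrite eaab in e2.
by apply: (addrI (W b x)); rewrite /turn addrA -e1 -addrA -e2 addrA addrC.
Qed.

(** Mutually skew [a] and [b] have conjugates that are inverse to each other, and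
    a round trip may be started from either of its end points. *)
Lemma turn_locally_skew : locally_skew C ->
  forall a b x y, turn W a x = turn W b y.
Proof.
move=> skew a b x y; rewrite (turn_const b y x).
elim: (skew a b) => {a b} [a b [_ ab]|//|a b c _ -> _ ->//].
by rewrite -(turn_qact a b) ab turn_qinv turn_qact.
Qed.

End ClosedLabelling.
End Labelling.

(** * Closed and exact forms in terms of labels *)

(** The left-hand side is the coefficient of theta (x) w + w (x) theta at
    (a, b), and the right-hand side the one at (b, a^b); the braiding moves
    the second to the first. *)
Lemma d1_eq0P (k : fieldType) (G : finGroupType) (S : {set G})
    (Sconj : forall a b, a \in S -> b \in S -> (a ^ b)%g \in S)
    (w : {ffun {a : G | a \in S} -> {ffun G -> k^o}}) :
  d1 w = 0 <-> forall (a b : {a : G | a \in S}) x,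
    w a x + w b (x * val a)%g
      = w b x + w (Sub (val a ^ val b)%g (Sconj _ _ (valP a) (valP b))) (x * val b)%g.
Proof.
rewrite d1E -[X in _ = X](linear0 (vclass _)) vclass_eq subr0.
rewrite memv_ker add_lfunE opp_lfunE id_lfunE lfunE subr_eq0.
split=> [/eqP tw a b x|tw].
  move/ffunP/(_ (a, b)): tw; rewrite PsiE => /ffunP/(_ x).
  by rewrite !ffunE /= !thetaE !ffunE /= !mul1r !mulr1 addrC => ->; rewrite addrC.
apply/eqP/ffunP=> -[a b]; rewrite PsiE; apply/ffunP=> x.
rewrite !ffunE /= !thetaE !ffunE /= !mul1r !mulr1 addrC tw.
by rewrite addrC.
Qed.

Section QuandleForms.

Variables (C : ipquandle) (k : fieldType).
Variables (C_emb : embeddable C) (G_fin : finite_set [set: assoc_group C]).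
Local Notation G := (assoc_finGroup G_fin).
Local Notation S := (quandle_image G_fin).
Local Notation idx := {a : G | a \in S}.
Local Notation Omega1 := {ffun idx -> {ffun G -> k^o}}.

Lemma fin_gen_image (a : C) : fin_gen G_fin a \in S.
Proof. by apply/quandle_imageP; exists a. Qed.

Definition gen_idx (a : C) : idx := Sub (fin_gen G_fin a) (fin_gen_image a).

Lemma gen_idx_surj (i : idx) : exists a, i = gen_idx a.
Proof.
by case/quandle_imageP: (valP i) => a ai; exists a; apply/val_inj; rewrite /= ai.
Qed.

Lemma quandle_image_conj (a b : G) : a \in S -> b \in S -> (a ^ b)%g \in S.
Proof. by have [_ _ + _] := quandle_image_calculus G_fin C_emb; apply. Qed.

Definition labelling (w : Omega1) (a : C) (x : assoc_group C) : k :=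
  w (gen_idx a) x.

Lemma d1_eq0_labelling (w : Omega1) :
  d1 w = 0 <-> closed_labelling C k (labelling w).
Proof.
rewrite (d1_eq0P _ _ _ quandle_image_conj).
have conj_idx (a b : C) : gen_idx (qact a b) =
    Sub (val (gen_idx a) ^ val (gen_idx b))%g
        (quandle_image_conj _ _ (valP (gen_idx a)) (valP (gen_idx b))).
  by apply/val_inj; apply: assoc_genJ.
split=> [wcl a b x|wcl i j x].
  by rewrite /labelling conj_idx; apply: wcl.
have [[a ->] [b ->]] := (gen_idx_surj i, gen_idx_surj j).
by have := wcl a b x; rewrite /labelling conj_idx.
Qed.

Lemma exact_labelling (w : Omega1) (f : assoc_group C -> k) :
    (forall a x, labelling w a x = f (x * assoc_gen a)%g - f x) ->
  w \in exact1 k S.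
Proof.
move=> wf; apply/exact1P; exists [ffun x : G => f x : k^o].
apply/ffunP=> i; have [a ->] := gen_idx_surj i; apply/ffunP=> x.
by rewrite d0E !ffunE; apply: wf.
Qed.

Lemma theta_labelling a x : labelling (theta k S) a x = 1.
Proof. by rewrite /labelling thetaE ffunE. Qed.

Lemma theta_closed : d1 (theta k S) = 0.
Proof. by apply/d1_eq0_labelling => a b x; rewrite !theta_labelling. Qed.

(** An exact form has vanishing round trips, whereas those of theta are 2. *)
Lemma theta_not_exact :
  inhabited C -> 2%N \notin [pchar k] -> theta k S \notin exact1 k S.
Proof.
move=> [a] k_char; apply/exact1P => -[f thetaf].
have step b x : (1 : k) = f (x * fin_gen G_fin b)%g - f x.
  rewrite -(theta_labelling b x) /labelling thetaf d0E !ffunE //.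
case/negP: k_char; rewrite inE /=; apply/eqP.
rewrite mulr2n {1}(step a 1%g) (step (qinv a) (1 * fin_gen G_fin a)%g).
by rewrite (mul_assoc_genV C 1%g a : (_ * fin_gen G_fin _)%g = _) subrKA subrr.
Qed.

Lemma closed_theta_exact (w : Omega1) :
    2%N \notin [pchar k] -> inhabited C -> locally_skew C -> d1 w = 0 ->
  exists c : k, w - c *: theta k S \in exact1 k S.
Proof.
move=> k_char [a0] skew w0.
have two_neq0 : 2%:R != 0 :> k by apply: contraNneq k_char => e; rewrite inE /= e.
have wcl := (d1_eq0_labelling w).1 w0.
(* Half the common label of the round trips of [w], as those of theta are 2. *)
pose c : k := turn C k (labelling w) a0 1%g / 2%:R.
exists c; set w' := _ - _.
have w'E a x : labelling w' a x = labelling w a x - c.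
  by rewrite /labelling !ffunE thetaE ffunE; congr (_ - _); apply: mulr1.
have w'cl : closed_labelling C k (labelling w').
  by apply/d1_eq0_labelling; rewrite linearB linearZ /= theta_closed w0 scaler0 subr0.
have [|f wf] := closed_turn0_potential C k _ w'cl; last exact: exact_labelling wf.
move=> a x; rewrite /turn !w'E addrACA -opprD.
have -> : c + c = turn C k (labelling w) a0 1%g.
  by rewrite -mulr2n -mulr_natr divfK.
by rewrite (turn_locally_skew C k _ wcl skew a0 a 1%g x) subrr.
Qed.

End QuandleForms.

Theorem theorem5p1 (C : ipquandle) (k : fieldType)
    (C_nonempty : inhabited C)
    (C_emb : embeddable C)
    (G_fin : finite_set [set: assoc_group C])
    (k_char : 2%N \notin [pchar k]) :
  let S := quandle_image G_fin in
  [/\ d1 (theta k S) = 0,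
      dR_class (theta k S) != 0,
      (<[dR_class (theta k S)]> <= HdR1 k S)%VS
    & locally_skew C -> HdR1 k S = <[dR_class (theta k S)]>%VS].
Proof.
move=> S; have theta0 := theta_closed C k C_emb G_fin.
have theta_sub : (<[dR_class (theta k S)]> <= HdR1 k S)%VS.
  by rewrite -memvE; apply/HdR1P; exists (theta k S).
have exact_eq0 w : dR_class w = 0 <-> w \in exact1 k S.
  by rewrite -[X in _ = X](linear0 (@dR_class k _ S)) vclass_eq subr0.
split=> //.
  apply/eqP => /exact_eq0; apply/negP.
  exact: theta_not_exact.
move=> skew; apply/eqP; rewrite eqEsubv theta_sub andbT.
apply/subvP => h /HdR1P[w w0 ->].
have [c /exact_eq0 wc] := closed_theta_exact C k C_emb G_fin w k_char C_nonempty skew w0.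
apply/vlineP; exists c; apply/eqP; rewrite -subr_eq0 -linearZ -linearB.
exact/eqP.
Qed.
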